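(* Let $\vec g=\langle g^\xi\rangle_{\xi\in\mathsf{On}}$ be a weak hyperation of a normal function $f:\mathsf{On}\to\mathsf{On}$, and let $\langle f_\alpha\rangle_{\alpha\in\mathsf{On}}$ be the Veblen progression of $f$. If moreover $g^{\omega^\alpha}=f_\alpha$ for each ordinal $\alpha$, then $\vec g=\mathrm{Hyp}[f]$, i.e. $\vec g$ is the hyperation of $f$.
   Context: $\mathsf{On}$ is the class of all ordinals. A function $f:\mathsf{On}\to\mathsf{On}$ is normal if it is strictly increasing and continuous, i.e. $f(\lambda)=\sup_{\xi<\lambda}f(\xi)$ for every limit ordinal $\lambda$. A weak hyperation of a normal function $f$ is a family $\langle g^\xi\rangle_{\xi\in\mathsf{On}}$ of normal functions such that $g^0=\mathrm{id}$, $g^1=f$, and $g^{\xi+\zeta}=g^\xi\circ g^\zeta$ for all ordinals $\xi,\zeta$. The hyperation $\mathrm{Hyp}[f]=\langle f^\xi\rangle_{\xi\in\mathsf{On}}$ of $f$ is the unique (always existing) weak hyperation of $f$ which is pointwise minimal: $f^\xi(\zeta)\le h^\xi(\zeta)$ for every weak hyperation $\langle h^\xi\rangle_{\xi\in\mathsf{On}}$ of $f$ and all ordinals $\xi,\zeta$. The Veblen progression $\langle f_\alpha\rangle_{\alpha\in\mathsf{On}}$ is defined by: $f_0=f$ and, for $\alpha>0$, $f_\alpha$ is the normal function enumerating in increasing order the class $\{\xi\mid \forall\beta<\alpha,\ f_\beta(\xi)=\xi\}$. *)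

(* Defs.v *)
From Stdlib Require Import Wf_nat Arith Lia Inverse_Image.
From Stdlib Require Import Classical ClassicalEpsilon FunctionalExtensionality
  PropExtensionality ProofIrrelevance.

Set Implicit Arguments.
Unset Strict Implicit.

(** Ordinals are order types of well-orders. The carriers of the well-orders
    range over one fixed universe, which plays the role of the universe of
    sets; the type [On] of their isomorphism classes lives one universe higher,
    and an arbitrary function [On -> On] plays the role of a class function. *)

Record wellOrder := WellOrder {
  car :> Type;
  ord : car -> car -> Prop;
  ord_wf : well_founded ord;
  ord_trans : forall x y z, ord x y -> ord y z -> ord x z;
  ord_total : forall x y, ord x y \/ x = y \/ ord y x }.

Definition iso (A B : wellOrder) : Prop :=
  exists (f : A -> B) (g : B -> A),
    (forall x, g (f x) = x) /\ (forall y, f (g y) = y) /\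
    (forall x y, ord x y <-> ord (f x) (f y)).

Lemma iso_refl A : iso A A.
Proof. exists (fun x => x), (fun x => x); firstorder. Qed.

Lemma iso_sym A B : iso A B -> iso B A.
Proof.
intros (f & g & fK & gK & fm); exists g, f; repeat split; auto.
- intros h; apply fm; rewrite !gK; exact h.
- intros h; apply fm in h; rewrite !gK in h; exact h.
Qed.

Lemma iso_trans A B C : iso A B -> iso B C -> iso A C.
Proof.
intros (f & g & fK & gK & fm) (f' & g' & fK' & gK' & fm').
exists (fun x => f' (f x)), (fun x => g (g' x)); split; [|split].
- intros x; rewrite fK'; auto.
- intros x; rewrite gK; auto.
- intros x y; rewrite fm; apply fm'.
Qed.

Definition On : Type := {P : wellOrder -> Prop | exists A, P = iso A}.

Definition otype (A : wellOrder) : On :=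
  exist _ (iso A) (ex_intro _ A eq_refl).

Lemma otypeP A B : otype A = otype B <-> iso A B.
Proof.
split.
- intros e; apply (f_equal (@proj1_sig _ _)) in e; simpl in e.
  rewrite e; apply iso_refl.
- intros i; apply subset_eq_compat; apply functional_extensionality; intros C.
  apply propositional_extensionality; split; intros h.
  + exact (iso_trans (iso_sym i) h).
  + exact (iso_trans i h).
Qed.

Lemma otype_surj (a : On) : exists A, a = otype A.
Proof.
destruct a as [P [A e]]; exists A; apply subset_eq_compat; exact e.
Qed.

Definition initial (A : wellOrder) (a : A) : wellOrder.
Proof.
refine (@WellOrder {x : A | ord x a}
          (fun x y => ord (proj1_sig x) (proj1_sig y)) _ _ _).
- apply (wf_inverse_image _ _ (@ord A) (@proj1_sig _ _)); apply ord_wf.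
- intros x y z; apply ord_trans.
- intros [x hx] [y hy]; simpl; destruct (ord_total x y) as [h|[h|h]]; auto.
  right; left; apply subset_eq_compat; exact h.
Defined.

Declare Scope on_scope.
Delimit Scope on_scope with on.
Bind Scope on_scope with On.
Local Open Scope on_scope.

Definition lt (a b : On) : Prop :=
  exists (B : wellOrder) (x : B), b = otype B /\ a = otype (initial x).
Notation "a < b" := (lt a b) : on_scope.

Definition le (a b : On) : Prop := a < b \/ a = b.
Notation "a <= b" := (le a b) : on_scope.

Lemma iso_initial (A B : wellOrder) (f : A -> B) (g : B -> A) (a : A) :
  (forall x, g (f x) = x) -> (forall y, f (g y) = y) ->
  (forall x y, ord x y <-> ord (f x) (f y)) ->
  iso (initial a) (initial (f a)).
Proof.
intros fK gK fm.
assert (hg : forall y, ord y (f a) -> ord (g y) a)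
  by (intros y h; apply fm; rewrite gK; exact h).
exists (fun x : initial a => exist (fun y : B => ord y (f a))
          (f (proj1_sig x)) (proj1 (fm _ _) (proj2_sig x))).
exists (fun y : initial (f a) => exist (fun x : A => ord x a)
          (g (proj1_sig y)) (hg _ (proj2_sig y))).
split; [|split].
- intros [x hx]; apply subset_eq_compat; apply fK.
- intros [x hx]; apply subset_eq_compat; apply gK.
- intros [x hx] [y hy]; simpl; apply fm.
Qed.

Lemma lt_otype (a : On) (B : wellOrder) :
  a < otype B <-> exists x : B, a = otype (initial x).
Proof.
split.
- intros (C & x & e & ->); apply otypeP, iso_sym in e.
  destruct e as (f & g & fK & gK & fm).
  exists (f x); apply otypeP; exact (iso_initial x fK gK fm).
- intros (x & ->); exists B, x; auto.
Qed.

Lemma initial_initial (A : wellOrder) (a : A) (x : initial a) :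
  otype (initial x) = otype (initial (proj1_sig x)).
Proof.
apply otypeP; destruct x as [x hx]; simpl.
set (X := exist _ x hx : initial a).
exists (fun z : initial X => exist (fun y : A => ord y x)
          (proj1_sig (proj1_sig z)) (proj2_sig z)).
exists (fun z : initial x => exist (fun y : initial a => ord y X)
          (exist (fun y : A => ord y a) (proj1_sig z) (ord_trans (proj2_sig z) hx)) (proj2_sig z)).
split; [|split].
- intros [[z hz] hz']; apply subset_eq_compat, subset_eq_compat; reflexivity.
- intros [z hz]; apply subset_eq_compat; reflexivity.
- intros [[z hz] hz'] [[y hy] hy']; reflexivity.
Qed.

Lemma otype_initial_lt (A : wellOrder) (x y : A) :
  ord x y -> otype (initial x) < otype (initial y).
Proof.
intros h; apply lt_otype; exists (exist _ x h); symmetry.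
apply (initial_initial (exist (fun z => ord z y) x h)).
Qed.

Lemma lt_wf : well_founded lt.
Proof.
assert (H : forall (A : wellOrder) (x : A), Acc lt (otype (initial x))).
{ intros A x; induction x as [x IH] using (well_founded_ind (@ord_wf A)).
  constructor; intros b hb; apply lt_otype in hb; destruct hb as [y ->].
  rewrite initial_initial; apply IH; exact (proj2_sig y). }
intros a; constructor; intros b (B & x & _ & ->); apply H.
Qed.

Lemma lt_trans a b c : a < b -> b < c -> a < c.
Proof.
destruct (otype_surj c) as [C ->]; intros hab hbc.
apply lt_otype in hbc; destruct hbc as [x ->].
apply lt_otype in hab; destruct hab as [y ->].
rewrite initial_initial; apply lt_otype; eauto.
Qed.

Lemma lt_irrefl a : ~ a < a.
Proof.
induction a as [a IH] using (well_founded_ind lt_wf).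
intros h; exact (IH a h h).
Qed.

Lemma otype_initial_ord (A : wellOrder) (x y : A) :
  otype (initial x) < otype (initial y) <-> ord x y.
Proof.
split; [|apply otype_initial_lt].
intros h; destruct (ord_total x y) as [h'|[->|h']]; auto.
- destruct (lt_irrefl h).
- destruct (lt_irrefl (lt_trans h (otype_initial_lt h'))).
Qed.

Lemma otype_initial_inj (A : wellOrder) (x y : A) :
  otype (initial x) = otype (initial y) -> x = y.
Proof.
intros e; destruct (ord_total x y) as [h|[h|h]]; auto;
  apply otype_initial_lt in h; rewrite e in h; destruct (lt_irrefl h).
Qed.

Lemma On_ext a b : (forall c, c < a <-> c < b) -> a = b.
Proof.
destruct (otype_surj a) as [A ->]; destruct (otype_surj b) as [B ->].
intros H; apply otypeP.
assert (hf : forall x : A, exists y : B,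
           otype (initial x) = otype (initial y)).
{ intros x; apply lt_otype, H, lt_otype; eauto. }
assert (hg : forall y : B, exists x : A,
           otype (initial y) = otype (initial x)).
{ intros x; apply lt_otype, H, lt_otype; eauto. }
exists (fun x => proj1_sig (constructive_indefinite_description _ (hf x))).
exists (fun y => proj1_sig (constructive_indefinite_description _ (hg y))).
split; [|split].
- intros x; destruct (constructive_indefinite_description _ (hf x)) as [y e].
  simpl; destruct (constructive_indefinite_description _ (hg y)) as [z e'].
  simpl; apply otype_initial_inj; congruence.
- intros y; destruct (constructive_indefinite_description _ (hg y)) as [x e].
  simpl; destruct (constructive_indefinite_description _ (hf x)) as [z e'].
  simpl; apply otype_initial_inj; congruence.
- intros x x'.
  destruct (constructive_indefinite_description _ (hf x)) as [y e].
  destruct (constructive_indefinite_description _ (hf x')) as [y' e'].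
  simpl; rewrite <- !otype_initial_ord, e, e'; reflexivity.
Qed.

Lemma lt_total a b : a < b \/ a = b \/ b < a.
Proof.
revert b; induction a as [a IHa] using (well_founded_ind lt_wf).
intros b; induction b as [b IHb] using (well_founded_ind lt_wf).
destruct (classic (a < b)) as [|nab]; auto.
destruct (classic (b < a)) as [|nba]; auto.
right; left; apply On_ext; intros c; split; intros h.
- destruct (IHa c h b) as [h'|[h'|h']]; auto.
  + subst; contradiction.
  + destruct (nba (lt_trans h' h)).
- destruct (IHb c h) as [h'|[h'|h']]; auto.
  + destruct (nab (lt_trans h' h)).
  + subst; contradiction.
Qed.

Lemma le_refl a : a <= a.
Proof. right; reflexivity. Qed.

Lemma le_antisym a b : a <= b -> b <= a -> a = b.
Proof.
intros [h|h] [h'|h']; auto; destruct (lt_irrefl (lt_trans h h')).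
Qed.

Lemma not_lt a b : ~ a < b <-> b <= a.
Proof.
split.
- intros h; destruct (lt_total a b) as [|[|]]; [tauto|right|left]; auto.
- intros [h|h] h'; [|subst]; [destruct (lt_irrefl (lt_trans h h'))|].
  destruct (lt_irrefl h').
Qed.

(** Replacement: a small family of ordinals is bounded. *)
Section Bounded.
Variables (I : Type) (F : I -> On).

Let rep (i : I) : wellOrder :=
  proj1_sig (constructive_indefinite_description _ (otype_surj (F i))).
Let repE i : F i = otype (rep i).
Proof.
unfold rep; destruct (constructive_indefinite_description _ _); assumption.
Qed.
Let pre : Type := (I + {i : I & rep i})%type.
Let val (s : pre) : On :=
  match s with
  | inl i => F i
  | inr p => otype (initial (projT2 p))
  end.
Let canon (s : pre) : pre := epsilon (inhabits s) (fun t => val t = val s).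
Let canonE s : val (canon s) = val s.
Proof. exact (epsilon_spec (inhabits s) (fun t => val t = val s) (ex_intro _ s eq_refl)). Qed.
Let canon_eq s t : val s = val t -> canon s = canon t.
Proof.
intros e; unfold canon; rewrite e.
rewrite (proof_irrelevance _ (inhabits s) (inhabits t)); reflexivity.
Qed.
Let bnd : wellOrder.
Proof.
refine (@WellOrder {s : pre | canon s = s}
          (fun x y => val (proj1_sig x) < val (proj1_sig y)) _ _ _).
- apply (wf_inverse_image _ _ lt (fun x => val (proj1_sig x))); apply lt_wf.
- intros x y z; apply lt_trans.
- intros [x hx] [y hy]; simpl.
  destruct (lt_total (val x) (val y)) as [h|[h|h]]; auto.
  right; left; apply subset_eq_compat; rewrite <- hx, <- hy.
  apply canon_eq; exact h.
Defined.

Let hasval s : exists x : bnd, val (proj1_sig x) = val s.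
Proof.
assert (h : canon (canon s) = canon s) by (apply canon_eq, canonE).
exists (exist (fun t => canon t = t) (canon s) h); apply canonE.
Qed.

Let down s b : b < val s -> exists x : bnd, val (proj1_sig x) = b.
Proof.
intros h; assert (exists t, val t = b) as [t <-]; [|apply hasval].
destruct s as [i|[i x]]; simpl in h.
- rewrite repE in h; apply lt_otype in h; destruct h as [x ->].
  exists (inr (existT _ i x)); reflexivity.
- apply lt_otype in h; destruct h as [y ->].
  exists (inr (existT _ i (proj1_sig y))); simpl.
  symmetry; apply initial_initial.
Qed.

Let bndE (x : bnd) : otype (initial x) = val (proj1_sig x).
Proof.
induction x as [x IH] using (well_founded_ind (@ord_wf bnd)).
apply On_ext; intros c; split; intros h.
- apply lt_otype in h; destruct h as [y ->].
  rewrite initial_initial, IH; exact (proj2_sig y).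
- destruct (down h) as [y <-].
  assert (h' : ord y x) by exact h.
  rewrite <- (IH y h'); apply otype_initial_lt; exact h'.
Qed.

Lemma small_bounded : exists z, forall i, F i < z.
Proof.
exists (otype bnd); intros i; destruct (hasval (inl i)) as [x e].
simpl in e; rewrite <- e, <- bndE; apply lt_otype; eauto.
Qed.
End Bounded.

Definition empty_order : wellOrder.
Proof. refine (@WellOrder Empty_set (fun _ _ => False) _ _ _); intros []. Defined.

Definition nat_order : wellOrder.
Proof. refine (@WellOrder nat Peano.lt Wf_nat.lt_wf _ _); intros; lia. Defined.

Definition zero : On := otype empty_order.
Definition omega : On := otype nat_order.

(** [least P] is the least ordinal in [P], and arbitrary if [P] is empty. *)
Definition least (P : On -> Prop) : On :=
  epsilon (inhabits zero) (fun a => P a /\ forall b, P b -> a <= b).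

Definition succ (a : On) : On := least (fun b => a < b).
Definition one : On := succ zero.

(** [sup P] is the least upper bound of [P], and arbitrary if [P] is
    unbounded. *)
Definition sup (P : On -> Prop) : On :=
  least (fun z => forall a, P a -> a <= z).

Definition limit (l : On) : Prop :=
  l <> zero /\ forall a, l <> succ a.

Lemma least_spec (P : On -> Prop) : (exists a, P a) ->
  P (least P) /\ forall b, P b -> least P <= b.
Proof.
intros [a Pa]; apply (epsilon_spec (inhabits zero)
  (fun a => P a /\ forall b, P b -> a <= b)).
revert Pa; induction a as [a IH] using (well_founded_ind lt_wf); intros Pa.
destruct (classic (exists b, b < a /\ P b)) as [(b & h & Pb)|n].
- exact (IH b h Pb).
- exists a; split; auto; intros b Pb; apply not_lt; intros h; eauto.
Qed.

Lemma bounded_below (a : On) (F : On -> On) :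
  exists z, forall b, b < a -> F b <= z.
Proof.
destruct (otype_surj a) as [A ->].
destruct (small_bounded (fun x : A => F (otype (initial x)))) as [z hz].
exists z; intros b h; apply lt_otype in h; destruct h as [x ->]; left; auto.
Qed.

Lemma zero_le a : zero <= a.
Proof.
apply not_lt; intros h; apply lt_otype in h; destruct h as [[] _].
Qed.

Lemma succ_spec a : a < succ a /\ forall b, a < b -> succ a <= b.
Proof.
apply (least_spec (P := fun b => a < b)).
destruct (small_bounded (fun _ : unit => a)) as [z hz]; exists z; exact (hz tt).
Qed.

Lemma lt_succ a : a < succ a.
Proof. apply succ_spec. Qed.

Lemma succ_inj a b : succ a = succ b -> a = b.
Proof.
intros e; destruct (lt_total a b) as [h|[h|h]]; auto; exfalso;
  apply succ_spec in h; apply not_lt in h; apply h;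
  [rewrite e|rewrite <- e]; apply lt_succ.
Qed.

Lemma succ_neq0 a : succ a <> zero.
Proof.
intros e; apply (proj2 (not_lt a zero) (zero_le a)).
rewrite <- e; apply lt_succ.
Qed.

Lemma sup_spec (P : On -> Prop) : (exists z, forall a, P a -> a <= z) ->
  (forall a, P a -> a <= sup P) /\
  (forall z, (forall a, P a -> a <= z) -> sup P <= z).
Proof. apply (least_spec (P := fun z => forall a, P a -> a <= z)). Qed.

Lemma limit_succ l a : limit l -> a < l -> succ a < l.
Proof.
intros [_ hl] h; apply succ_spec in h; destruct h as [|e]; auto.
destruct (hl a); auto.
Qed.

Lemma omega_limit : limit omega.
Proof.
split.
- intros e; apply (proj2 (not_lt (otype (initial (0 : nat_order))) zero)).
  + apply zero_le.
  + rewrite <- e; apply lt_otype; eauto.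
- intros a e; assert (h : a < omega) by (rewrite e; apply lt_succ).
  apply lt_otype in h; destruct h as [n ->].
  assert (h' : otype (initial (n : nat_order)) <
               otype (initial (S n : nat_order)))
    by (apply otype_initial_lt; simpl; lia).
  apply succ_spec, not_lt in h'; apply h'; rewrite <- e.
  apply lt_otype; eauto.
Qed.

Lemma omega_least l : limit l -> omega <= l.
Proof.
intros hl; apply not_lt; intros h; apply lt_otype in h; destruct h as [n e].
assert (H : forall n, otype (initial (n : nat_order)) < l).
{ clear n e; intros n; induction n as [|n IH].
  - destruct (zero_le l) as [h|h]; [|destruct hl; congruence].
    replace (otype (initial (0 : nat_order))) with zero; auto.
    apply le_antisym; [apply zero_le|apply not_lt; intros h'].
    apply lt_otype in h'; destruct h' as [[x hx] _]; simpl in hx; lia.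
  - apply (limit_succ hl) in IH.
    replace (otype (initial (S n : nat_order)))
      with (succ (otype (initial (n : nat_order)))); auto.
    apply le_antisym.
    + apply succ_spec, otype_initial_lt; simpl; lia.
    + apply not_lt; intros h; apply lt_otype in h; destruct h as [[x hx] e].
      rewrite initial_initial in e; simpl in e, hx.
      assert (h : otype (initial (n : nat_order)) <
                  otype (initial (x : nat_order)))
        by (rewrite <- e; apply lt_succ).
      apply otype_initial_ord in h; simpl in h; lia. }
apply (@lt_irrefl l); rewrite e at 1; apply H.
Qed.

(** [transrec z s] is the function [F] with [F 0 = z], [F (a + 1) = s (F a)]
    and [F l = sup (F b | b < l)] at limits; see the three equations below. *)

Lemma pred_lt a b : a = succ b -> b < a.
Proof. intros ->; apply lt_succ. Qed.

Definition transrec_step (z : On) (s : On -> On) (a : On)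
    (rec : forall b, b < a -> On) : On :=
  if excluded_middle_informative (a = zero) then z else
  match excluded_middle_informative (exists b, a = succ b) with
  | left e =>
      let (b, hb) := constructive_indefinite_description _ e in
      s (rec b (pred_lt hb))
  | right _ => sup (fun y => exists b (hb : b < a), y = rec b hb)
  end.

Definition transrec (z : On) (s : On -> On) : On -> On :=
  Fix lt_wf (fun _ => On) (transrec_step z s).

Lemma transrecE z s a :
  transrec z s a = transrec_step z s (fun b (_ : b < a) => transrec z s b).
Proof.
unfold transrec; rewrite Fix_eq; auto.
intros x f g h; replace g with f; auto.
apply functional_extensionality_dep; intros y.
apply functional_extensionality; intros p; apply h.
Qed.

Lemma transrec0 z s : transrec z s zero = z.
Proof.
rewrite transrecE; unfold transrec_step.
destruct (excluded_middle_informative _); tauto.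
Qed.

Lemma transrecS z s a : transrec z s (succ a) = s (transrec z s a).
Proof.
rewrite transrecE; unfold transrec_step.
destruct (excluded_middle_informative _) as [e|_].
- destruct (succ_neq0 e).
- destruct (excluded_middle_informative _) as [e|n].
  + destruct (constructive_indefinite_description _ e) as [b hb].
    apply succ_inj in hb; subst; reflexivity.
  + destruct n; eauto.
Qed.

Lemma transrec_limit z s l : limit l ->
  transrec z s l = sup (fun y => exists b, b < l /\ y = transrec z s b).
Proof.
intros [l0 lS]; rewrite transrecE; unfold transrec_step.
destruct (excluded_middle_informative _) as [e|_]; [contradiction|].
destruct (excluded_middle_informative _) as [[b e]|_]; [destruct (lS b e)|].
f_equal; apply functional_extensionality; intros y.
apply propositional_extensionality; split.
- intros (b & hb & e); eauto.
- intros (b & hb & e); eauto.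
Qed.

Definition add (a b : On) : On := transrec a succ b.
Notation "a + b" := (add a b) : on_scope.

Definition mul (a b : On) : On := transrec zero (fun c => c + a) b.
Notation "a * b" := (mul a b) : on_scope.

Definition omega_pow (a : On) : On := transrec one (fun c => c * omega) a.

Definition strictly_increasing (f : On -> On) : Prop :=
  forall a b, a < b -> f a < f b.

Definition continuous (f : On -> On) : Prop :=
  forall l, limit l -> f l = sup (fun y => exists x, x < l /\ y = f x).

Definition normal (f : On -> On) : Prop :=
  strictly_increasing f /\ continuous f.

Definition weak_hyperation (f : On -> On) (g : On -> On -> On) : Prop :=
  (forall x, normal (g x)) /\
  (forall z, g zero z = z) /\
  (forall z, g one z = f z) /\
  (forall x y z, g (x + y) z = g x (g y z)).

(** [g = Hyp[f]]; there is at most one such [g], by [hyperation_unique]. *)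
Definition hyperation (f : On -> On) (g : On -> On -> On) : Prop :=
  weak_hyperation f g /\
  forall h, weak_hyperation f h -> forall x z, g x z <= h x z.

Lemma hyperation_unique f g g' : hyperation f g -> hyperation f g' -> g = g'.
Proof.
intros [w m] [w' m']; apply functional_extensionality; intros x.
apply functional_extensionality; intros z; apply le_antisym; auto.
Qed.

Definition enumerates (g : On -> On) (C : On -> Prop) : Prop :=
  strictly_increasing g /\ forall x, C x <-> exists z, g z = x.

Definition veblen_progression (f : On -> On) (F : On -> On -> On) : Prop :=
  (forall z, F zero z = f z) /\
  forall a, zero < a ->
    normal (F a) /\ enumerates (F a) (fun x => forall b, b < a -> F b x = x).

(* Main.v *)
(** If [h] is any weak hyperation of [f], then [h^(w^a)] dominates [f_a], by
    induction on [a]: since [w^b + w^a = w^a] for [b < a], every value [y] of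
    [h^(w^a)] is fixed by [h^(w^b)], and [y <= f_b y <= h^(w^b) y = y] makes it
    a fixed point of [f_b]; so the range of [h^(w^a)] is included in that of
    [f_a]. Since every nonzero ordinal is [w^a + r] with a smaller [r], this
    carries over from the powers of [w] to all exponents. *)
Require Import Defs.
From Stdlib Require Import Classical FunctionalExtensionality PropExtensionality.
Local Open Scope on_scope.

(** * Order and induction principles *)

Lemma lt_le_trans a b c : a < b -> b <= c -> a < c.
Proof. intros h [h'| <-]; auto. exact (lt_trans h h'). Qed.

Lemma le_lt_trans a b c : a <= b -> b < c -> a < c.
Proof. intros [h| ->] h'; auto. exact (lt_trans h h'). Qed.

Lemma le_trans a b c : a <= b -> b <= c -> a <= c.
Proof. intros [h| ->] h'; auto. left; exact (lt_le_trans _ _ _ h h'). Qed.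

Lemma le_not_lt a b : a <= b -> ~ b < a.
Proof. apply not_lt. Qed.

Lemma lt_succ_le a b : a < succ b -> a <= b.
Proof.
  intros h; apply not_lt; intros h'.
  exact (le_not_lt _ _ (proj2 (succ_spec b) _ h') h).
Qed.

Lemma zero_succ_limit a : a = zero \/ (exists b, a = succ b) \/ limit a.
Proof.
  destruct (classic (a = zero)) as [|n0]; auto.
  destruct (classic (exists b, a = succ b)) as [|nS]; auto.
  right; right; split; eauto.
Qed.

Lemma On_ind (P : On -> Prop) :
  P zero -> (forall a, P a -> P (succ a)) ->
  (forall l, limit l -> (forall a, a < l -> P a) -> P l) ->
  forall a, P a.
Proof.
  intros P0 PS Pl a; induction a as [a IH] using (well_founded_ind lt_wf).
  destruct (zero_succ_limit a) as [->|[[b ->]|hl]]; auto using lt_succ.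
Qed.

(** The limit case of [On_ind] is vacuous below [omega], the least limit. *)
Lemma finite_ind (P : On -> Prop) :
  P zero -> (forall n, n < omega -> P n -> P (succ n)) ->
  forall n, n < omega -> P n.
Proof.
  intros P0 PS n; induction n as [|n IH|l hl _] using On_ind; intros hn; auto.
  - assert (n < omega) by exact (lt_trans (lt_succ n) hn); auto.
  - destruct (le_not_lt _ _ (omega_least hl) hn).
Qed.

Lemma limit_gt0 l : limit l -> zero < l.
Proof. intros [n0 _]; destruct (zero_le l) as [|e]; congruence. Qed.

Lemma limit_dense l a : limit l -> a < l -> exists b, b < l /\ a < b.
Proof. intros hl h; exists (succ a); auto using limit_succ, lt_succ. Qed.

(** * Continuous and normal functions *)

Lemma continuous_le f l z : continuous f -> limit l ->
  (forall x, x < l -> f x <= z) -> f l <= z.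
Proof.
  intros hc hl h; rewrite (hc l hl); apply sup_spec.
  - exists z; intros y (x & hx & ->); auto.
  - intros y (x & hx & ->); auto.
Qed.

(** Since [sup] is arbitrary on unbounded classes, [f l] itself serves as the bound that [sup_spec]
    requires. *)
Lemma continuous_intro f :
  (forall l, limit l -> (forall x, x < l -> f x <= f l) /\
     forall z, (forall x, x < l -> f x <= z) -> f l <= z) ->
  continuous f.
Proof.
  intros h l hl; destruct (h l hl) as [hub hlub].
  assert (s := sup_spec (P := fun y => exists x, x < l /\ y = f x)).
  destruct s as [s1 s2]; [exists (f l); intros y (x & hx & ->); auto|].
  apply le_antisym.
  - apply hlub; intros x hx; apply s1; eauto.
  - apply s2; intros y (x & hx & ->); auto.
Qed.

Lemma increasing_le f a b : strictly_increasing f -> a <= b -> f a <= f b.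
Proof. intros hf [h| ->]; [left; auto|apply le_refl]. Qed.

(** If [f a < a], then [f (f a) < f a], against the induction hypothesis at [f a]. *)
Lemma increasing_ge_id f a : strictly_increasing f -> a <= f a.
Proof.
  intros hf; induction a as [a IH] using (well_founded_ind lt_wf).
  apply not_lt; intros h; exact (le_not_lt _ _ (IH _ h) (hf _ _ h)).
Qed.

(** If [f l] were [succ a], every earlier value would be at most [a], hence so would [f l] by
    continuity. *)
Lemma increasing_limit f l : strictly_increasing f -> continuous f ->
  limit l -> limit (f l).
Proof.
  intros hf hc hl; split.
  - intros e; assert (h := limit_gt0 l hl); apply hf in h.
    rewrite e in h; exact (le_not_lt _ _ (zero_le _) h).
  - intros a e; apply (lt_irrefl (a := a)).
    apply lt_le_trans with (1 := lt_succ a); rewrite <- e.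
    apply continuous_le; auto.
    intros x hx; apply lt_succ_le; rewrite <- e; auto.
Qed.

Lemma normal_comp f g : normal f -> normal g -> normal (fun x => f (g x)).
Proof.
  intros [fi fc] [gi gc]; split; [intros a b h; auto|].
  apply continuous_intro; intros l hl; split.
  - intros x hx; left; auto.
  - intros z hz; apply continuous_le; auto using increasing_limit.
    (* By continuity of [g], some [x < l] has [y < g x]; then [f y < f (g x) <= z]. *)
    intros y hy; apply not_lt; intros h.
    apply (le_not_lt (g l) y); auto; apply continuous_le; auto.
    intros x hx; apply not_lt; intros hyx.
    apply (le_not_lt _ _ (hz x hx)), (lt_trans h); auto.
Qed.

(** The arithmetic laws below are proved by this principle: continuity settles the limit case once
    and for all. *)
Lemma continuous_ext f g : continuous f -> continuous g ->
  f zero = g zero ->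
  (forall a, f a = g a -> f (succ a) = g (succ a)) ->
  forall a, f a = g a.
Proof.
  intros hf hg h0 hS a; induction a as [|a IH|l hl IH] using On_ind; auto.
  rewrite (hf l hl), (hg l hl); f_equal.
  apply functional_extensionality; intros y.
  apply propositional_extensionality.
  split; intros (x & hx & ->); exists x; split; auto; symmetry; auto.
Qed.

(** The least [u] with [y < f u] is not zero by hypothesis and not a limit by continuity, so it is a
    successor [succ x]. *)
Lemma normal_floor f y : normal f -> f zero <= y ->
  exists x, f x <= y /\ y < f (succ x).
Proof.
  intros [hi hc] h0.
  destruct (least_spec (P := fun u => y < f u)) as [hu hmin].
  { exists (succ y); apply lt_le_trans with (1 := lt_succ y).
    apply increasing_ge_id; auto. }
  set (u := least _) in *; clearbody u.
  assert (hlow : forall x, x < u -> f x <= y).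
  { intros x hx; apply not_lt; intros h; exact (le_not_lt _ _ (hmin x h) hx). }
  destruct (zero_succ_limit u) as [->|[[x ->]|hl]].
  - destruct (le_not_lt _ _ h0 hu).
  - exists x; auto using lt_succ.
  - apply not_lt in hu as []; apply continuous_le; auto.
Qed.

(** Growth of [s] is asked only from [z] on, because multiplication by [omega] fixes zero; the
    induction therefore also carries the lower bound [z]. *)
Lemma transrec_normal z s : (forall x, z <= x -> x < s x) ->
  normal (transrec z s).
Proof.
  intros hs.
  assert (H : forall b, z <= transrec z s b /\
                forall a, a < b -> transrec z s a < transrec z s b).
  { intros b; induction b as [|b [IH1 IH2]|l hl IH] using On_ind.
    - rewrite transrec0; split; [apply le_refl|].
      intros a h; destruct (le_not_lt _ _ (zero_le a) h).
    - rewrite transrecS; assert (h := hs _ IH1); split.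
      + left; exact (le_lt_trans _ _ _ IH1 h).
      + intros a ha; apply lt_succ_le in ha as [ha| ->]; auto.
        exact (lt_trans (IH2 a ha) h).
    - rewrite (transrec_limit z s hl).
      (* Replacement bounds the earlier values, so that their [sup] is a genuine supremum. *)
      destruct (bounded_below l (transrec z s)) as [w hw].
      destruct (sup_spec (P := fun y => exists b, b < l /\ y = transrec z s b))
        as [hub _].
      { exists w; intros y (b & hb & ->); auto. }
      assert (h : forall a, a < l -> transrec z s a < sup
                    (fun y => exists b, b < l /\ y = transrec z s b)).
      { intros a ha; destruct (limit_dense l a hl ha) as (b & hb & hab).
        apply lt_le_trans with (transrec z s b); [apply IH; auto|].
        apply hub; eauto. }
      split; auto.
      assert (h0 := limit_gt0 l hl).
      left; apply le_lt_trans with (transrec z s zero); auto.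
      apply IH; auto. }
  split; [intros a b; apply H|exact (transrec_limit z s)].
Qed.

(** * Ordinal addition *)

Lemma add_normal a : normal (add a).
Proof. apply transrec_normal; intros x _; apply lt_succ. Qed.

Lemma add0 a : a + zero = a.
Proof. apply transrec0. Qed.

Lemma addS a b : a + succ b = succ (a + b).
Proof. apply transrecS. Qed.

Lemma id_normal : normal (fun x => x).
Proof.
  split; [intros a b; auto|apply continuous_intro; intros l hl; split].
  - intros x; left; auto.
  - intros z hz; apply not_lt; intros h.
    destruct (limit_dense l z hl h) as (b & hb & hzb).
    exact (le_not_lt _ _ (hz b hb) hzb).
Qed.

Lemma zero_add a : zero + a = a.
Proof.
  apply (continuous_ext (add zero) (fun x => x)).
  - apply add_normal.
  - apply id_normal.
  - apply add0.
  - intros b e; rewrite addS, e; reflexivity.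
Qed.

Lemma addA a b c : a + (b + c) = a + b + c.
Proof.
  apply (continuous_ext (fun x => a + (b + x)) (add (a + b))).
  - apply (normal_comp (add a) (add b)); apply add_normal.
  - apply add_normal.
  - rewrite !add0; reflexivity.
  - intros x e; rewrite !addS, e; reflexivity.
Qed.

Lemma le_add_r a b : a <= a + b.
Proof.
  rewrite <- (add0 a) at 1.
  apply increasing_le; [apply add_normal|apply zero_le].
Qed.

Lemma le_add_l a b : b <= a + b.
Proof. apply increasing_ge_id, add_normal. Qed.

Lemma le_add_ex a b : a <= b -> exists c, b = a + c.
Proof.
  intros h; destruct (normal_floor (add a) b (add_normal a)) as (c & h1 & h2).
  { rewrite add0; exact h. }
  exists c; apply le_antisym; auto.
  rewrite addS in h2; apply lt_succ_le; exact h2.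
Qed.

Lemma one_lt_omega : one < omega.
Proof. apply limit_succ; auto using limit_gt0, omega_limit. Qed.

Lemma one_add_omega : one + omega = omega.
Proof.
  apply le_antisym; [|apply le_add_l].
  apply (continuous_le (add one)); [apply add_normal|apply omega_limit|].
  intros n hn; left; revert n hn; apply finite_ind.
  - rewrite add0; exact one_lt_omega.
  - intros n _ h; rewrite addS; apply limit_succ; auto using omega_limit.
Qed.

(** * Ordinal multiplication *)

Lemma mul_normal a : zero < a -> normal (mul a).
Proof.
  intros ha; apply transrec_normal; intros x _.
  rewrite <- (add0 x) at 1; apply add_normal; exact ha.
Qed.

Lemma mul0 a : a * zero = zero.
Proof. apply transrec0. Qed.

Lemma mulS a b : a * succ b = a * b + a.
Proof. apply (transrecS zero (fun c => c + a)). Qed.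

Lemma mul1 a : a * one = a.
Proof. unfold one; rewrite mulS, mul0; apply zero_add. Qed.

Lemma mulDr a b c : zero < a -> a * (b + c) = a * b + a * c.
Proof.
  intros ha.
  apply (continuous_ext (fun x => a * (b + x)) (fun x => a * b + a * x)).
  - apply (normal_comp (mul a) (add b)); auto using mul_normal, add_normal.
  - apply (normal_comp (add (a * b)) (mul a)); auto using mul_normal, add_normal.
  - rewrite mul0, !add0; reflexivity.
  - intros x e; rewrite addS, !mulS, e, addA; reflexivity.
Qed.

Lemma add_mul_omega a : zero < a -> a + a * omega = a * omega.
Proof.
  intros ha; rewrite <- (mul1 a) at 1.
  rewrite <- mulDr, one_add_omega; auto.
Qed.

(** Iterating [a + x = x] gives [a * n + x = x], so [a * n <= x] for every finite [n]; continuity of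
    [mul a] passes to [omega]. *)
Lemma mul_omega_le a x : zero < a -> a + x = x -> a * omega <= x.
Proof.
  intros ha e.
  apply (continuous_le (mul a)); [apply mul_normal, ha|apply omega_limit|].
  intros n hn; assert (h : a * n + x = x).
  { revert n hn; apply finite_ind.
    - rewrite mul0; apply zero_add.
    - intros n _ IH; rewrite mulS, <- addA, e; exact IH. }
  rewrite <- h; apply le_add_r.
Qed.

(** * Powers of [omega] *)

Lemma zero_lt_one : zero < one.
Proof. apply lt_succ. Qed.

Lemma omega_pow_normal : normal omega_pow.
Proof.
  apply transrec_normal; intros x hx.
  rewrite <- (mul1 x) at 1; apply mul_normal, one_lt_omega.
  exact (lt_le_trans _ _ _ zero_lt_one hx).
Qed.

Lemma omega_pow0 : omega_pow zero = one.
Proof. apply transrec0. Qed.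

Lemma omega_powS a : omega_pow (succ a) = omega_pow a * omega.
Proof. apply (transrecS one (fun c => c * omega)). Qed.

Lemma omega_pow_gt0 a : zero < omega_pow a.
Proof.
  apply lt_le_trans with (1 := zero_lt_one); rewrite <- omega_pow0.
  apply increasing_le; [apply omega_pow_normal|apply zero_le].
Qed.

(** Write [omega_pow a] as [omega_pow (succ b) + c]; the first summand is [omega_pow b * omega],
    which absorbs [omega_pow b] on its left because [one + omega = omega]. *)
Lemma omega_pow_absorb a b : b < a ->
  omega_pow b + omega_pow a = omega_pow a.
Proof.
  intros h; apply succ_spec in h.
  apply (increasing_le omega_pow) in h; [|apply omega_pow_normal].
  apply le_add_ex in h as [c ->].
  rewrite omega_powS, addA, add_mul_omega; auto using omega_pow_gt0.
Qed.

(** Take the largest power below or equal to [x]. If the remainder were [x] itself, [mul_omega_le]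
    would put the next power below or equal to [x] too. *)
Lemma omega_pow_decomp x : zero < x ->
  exists a r, x = omega_pow a + r /\ r < x.
Proof.
  intros hx; destruct (normal_floor omega_pow x omega_pow_normal)
    as (a & h1 & h2).
  { rewrite omega_pow0; apply succ_spec; exact hx. }
  destruct (le_add_ex _ _ h1) as [r e]; exists a, r; split; auto.
  assert (hr : r <= x) by (rewrite e; apply le_add_l).
  destruct hr as [| ->]; auto; exfalso.
  rewrite omega_powS in h2; refine (le_not_lt _ _ _ h2).
  apply mul_omega_le; auto using omega_pow_gt0.
Qed.

(** * Comparison of the Veblen progression with weak hyperations *)

(** Let [g z = f w]. If [w < z], induction gives [f w <= g w < g z = f w], which is absurd; so
    [z <= w] and [f z <= f w]. *)
Lemma increasing_range_le f g : strictly_increasing f ->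
  strictly_increasing g -> (forall z, exists w, f w = g z) ->
  forall z, f z <= g z.
Proof.
  intros hf hg h z; induction z as [z IH] using (well_founded_ind lt_wf).
  destruct (h z) as [w e]; rewrite <- e; apply increasing_le; auto.
  apply not_lt; intros hw; apply (le_not_lt _ _ (IH w hw)).
  rewrite e; auto.
Qed.

Lemma veblen_le_weak_hyperation f h F :
  normal f -> weak_hyperation f h -> veblen_progression f F ->
  forall a z, F a z <= h (omega_pow a) z.
Proof.
  intros hf (hn & h0 & h1 & hD) [F0 FS] a.
  induction a as [a IH] using (well_founded_ind lt_wf).
  destruct (zero_le a) as [ha| <-].
  2: { intros z; rewrite omega_pow0, F0, h1; apply le_refl. }
  destruct (FS a ha) as [_ [Fi FE]].
  apply increasing_range_le; [exact Fi|apply hn|].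
  intros z; apply FE; intros b hb.
  apply le_antisym.
  - apply le_trans with (1 := IH b hb _).
    rewrite <- hD, omega_pow_absorb; auto using le_refl.
  (* The Veblen clause provides normality only at positive indices; at index zero, monotonicity
     comes from [f]. *)
  - apply increasing_ge_id; destruct (zero_le b) as [hb0| <-].
    + apply FS; exact hb0.
    + intros x y; rewrite !F0; apply hf.
Qed.

Theorem theorem4p11 (f : On -> On) (g F : On -> On -> On)
  (hf : normal f)
  (hg : weak_hyperation f g)
  (hF : veblen_progression f F)
  (hgF : forall a z : On, g (omega_pow a) z = F a z) :
  hyperation f g.
Proof.
  split; [exact hg|]; intros h hh x.
  assert (key := veblen_le_weak_hyperation f h F hf hh hF).
  destruct hg as (gn & g0 & _ & gD), hh as (_ & h0 & _ & hD).
  induction x as [x IH] using (well_founded_ind lt_wf); intros z.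
  destruct (zero_le x) as [hx| <-]; [|rewrite g0, h0; apply le_refl].
  destruct (omega_pow_decomp x hx) as (a & r & e & hr).
  specialize (IH r hr z); rewrite e, gD, hD.
  (* Change the inner function first, by induction and monotonicity of [g (omega_pow a)], then the
     outer one, where [g (omega_pow a)] is [F a]. *)
  apply le_trans with (g (omega_pow a) (h r z)).
  - apply increasing_le; [apply gn|exact IH].
  - rewrite hgF; apply key.
Qed.
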